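(* Let $\mathbb X,\mathbb Y$ be Hilbert spaces over $\mathbb K\in\{\mathbb R,\mathbb C\}$, let $\mathbf A\colon\mathbb X\to\mathbb Y$ be bounded linear, let $(\mathbf U,\mathbf V,\boldsymbol\kappa)=(u_\lambda,v_\lambda,\kappa_\lambda)_{\lambda\in\Lambda}$ be a diagonal frame decomposition (DFD) for $\mathbf A$, and let $\boldsymbol d=(d_\lambda)_{\lambda\in\Lambda}\in\mathbb R^\Lambda$ satisfy $\inf_{\lambda\in\Lambda}d_\lambda>0$. For $\alpha>0$ let $\mathbf B_\alpha^{\rm DFD}:=\bar{\mathbf U}\circ\mathbf M_{\boldsymbol\kappa}^{+}\circ\mathbb S_{\alpha\boldsymbol d/\boldsymbol\kappa}\circ\mathbf V^*$ be the DFD soft-thresholding estimator. Then: (a) (Existence) $\mathbf B_\alpha^{\rm DFD}\colon\mathbb Y\to\mathbb X$ is well-defined for all $\alpha>0$ (that is, $\mathbf M_{\boldsymbol\kappa}^{+}\mathbb S_{\alpha\boldsymbol d/\boldsymbol\kappa}(\mathbf V^*y)\in\ell^2(\Lambda)$ for every $y\in\mathbb Y$). (b) (Stability) $\mathbf B_\alpha^{\rm DFD}\colon\mathbb Y\to\mathbb X$ is continuous for all $\alpha>0$. (c) (Convergence) Let $y=\mathbf A x^{+}$ for some $x^{+}\in\mathbb X$ with $\sum_{\lambda\in\Lambda}d_\lambda|\langle x^+,u_\lambda\rangle|<\infty$. Let $(y^k)_{k\in\mathbb N}\in\mathbb Y^{\mathbb N}$ satisfy $\|y^k-y\|\le\delta_k$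 with $\delta_k\to0$, and let $(\alpha_k)_{k\in\mathbb N}\in(0,\infty)^{\mathbb N}$ satisfy $\lim_{k\to\infty}\alpha_k=\lim_{k\to\infty}\delta_k^2/\alpha_k=0$. Then $\|\mathbf B_{\alpha_k}^{\rm DFD}(y^k)-x^{+}\|\to0$ as $k\to\infty$.
   Context: A diagonal frame decomposition (DFD) for $\mathbf A$ is a family $(u_\lambda,v_\lambda,\kappa_\lambda)_{\lambda\in\Lambda}$ with $u_\lambda\in\mathbb X$, $v_\lambda\in\mathbb Y$, $\kappa_\lambda>0$ such that: (D1) $(u_\lambda)_\lambda$ is a frame of $\mathbb X$; (D2) $(v_\lambda)_\lambda$ is a frame of $\overline{\operatorname{ran}(\mathbf A)}$; (D3) $\mathbf A^*v_\lambda=\kappa_\lambda u_\lambda$ for all $\lambda\in\Lambda$. (A frame of a Hilbert space $H$ is a family $(f_\lambda)$ in $H$ with constants $0<a\le b<\infty$ such that $a\|x\|^2\le\sum_\lambda|\langle x,f_\lambda\rangle|^2\le b\|x\|^2$ for all $x\in H$.) The synthesis operator of the frame $(u_\lambda)_\lambda$ is $\mathbf U\colon\ell^2(\Lambda)\to\mathbb X$, $\xi\mapsto\sum_\lambda\xi_\lambda u_\lambda$, with adjoint (analysis operator) $\mathbf U^*x=(\langle x,u_\lambda\rangle)_\lambda$; likewise $\mathbf V$ for $(v_\lambda)_\lambda$, with $\mathbf V^*\colon\mathbb Y\to\ell^2(\Lambda)$, $\mathbf V^*y=(\langle y,v_\lambda\rangle)_\lambda$ (inner products are linear in the first argument). $\bar{\mathbf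 U}$ is the synthesis operator of the canonical dual frame $(\bar u_\lambda)_\lambda$ of $(u_\lambda)_\lambda$, $\bar u_\lambda=(\mathbf U\mathbf U^* )^{-1}u_\lambda$, so that $\bar{\mathbf U}\mathbf U^*=\operatorname{Id}_{\mathbb X}$. Soft-thresholding: for $\eta\in\mathbb K$ and $d\ge 0$, $\operatorname{soft}(\eta,d):=\operatorname{sign}(\eta)\max\{0,|\eta|-d\}$ with $\operatorname{sign}(\eta)=\eta/|\eta|$ for $\eta\ne0$ and $\operatorname{sign}(0)=0$; for families, $\mathbb S_{\boldsymbol d}(\boldsymbol\eta):=(\operatorname{soft}(\eta_\lambda,d_\lambda))_{\lambda}$. Here $\alpha\boldsymbol d/\boldsymbol\kappa=(\alpha d_\lambda/\kappa_\lambda)_\lambda$. $\mathbf M_{\boldsymbol\kappa}^+$ is pointwise division, $(\mathbf M_{\boldsymbol\kappa}^+\boldsymbol\eta)_\lambda=\eta_\lambda/\kappa_\lambda$. *)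

(* Defs.v *)
From HB Require Import structures.
From mathcomp Require Import all_boot all_order all_algebra.
From mathcomp Require Import complex.
From mathcomp Require Import all_classical all_reals all_analysis.
From mathcomp Require summability.
Set Implicit Arguments.
Unset Strict Implicit.
Unset Printing Implicit Defensive.
Import Order.TTheory GRing.Theory Num.Theory.
Import numFieldNormedType.Exports.
Local Open Scope classical_set_scope.
Local Open Scope ring_scope.

Variant scalar_kind := RealScalars | ComplexScalars.

Definition scalars (R : realType) (k : scalar_kind) : numFieldType :=
  match k with RealScalars => R | ComplexScalars => complex R end.

Definition conjK (R : realType) (k : scalar_kind) :
    scalars R k -> scalars R k :=
  match k with RealScalars => idfun | ComplexScalars => @conjc R end.

Definition reK (R : realType) (k : scalar_kind) : scalars R k -> R :=
  match k with RealScalars => idfun | ComplexScalars => @complex.Re R end.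

Definition ofR (R : realType) (k : scalar_kind) : R -> scalars R k :=
  match k with RealScalars => idfun | ComplexScalars => real_complex R end.
Arguments ofR {R} k.

(* Norms of the libraries take their values in the scalar field (in R[i] when
   the scalars are complex); [normR] is the same norm, read as an element of R. *)
Definition normR (R : realType) (k : scalar_kind)
    (V : normedZmodType (scalars R k)) (x : V) : R := reK `|x|.

(* A {dot V for conjK} form is positive definite, linear in its first argument
   and conjugate-linear in its second. *)
HB.mixin Record CompleteNormedModule_isHilbert (R : realType) (k : scalar_kind)
    V & CompleteNormedModule (scalars R k) V := {
  dot : {dot V for @conjK R k} ;
  dot_norm : forall x : V, dot x x = `|x| ^+ 2
}.

#[short(type="hilbertType")]
HB.structure Definition Hilbert (R : realType) (k : scalar_kind) :=
  { V of CompleteNormedModule (scalars R k) V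
       & CompleteNormedModule_isHilbert R k V }.

Section Frames.
Variables (R : realType) (k : scalar_kind) (L : choiceType).
Local Notation K := (scalars R k).

Definition l2 (xi : L -> K) : Prop :=
  (\esum_(l in [set: L]) (normR (xi l) ^+ 2)%:E < +oo)%E.

Section OneSpace.
Variable H : hilbertType R k.

(* [S] is the closed subspace of H for which [f] is required to be a frame. *)
Definition frame (S : set H) (f : L -> H) : Prop :=
  (forall l, S (f l)) /\
  exists a b : R, [/\ 0 < a, a <= b & forall x, S x ->
    ((a * normR x ^+ 2)%:E
       <= \esum_(l in [set: L]) (normR (dot x (f l)) ^+ 2)%:E
       <= (b * normR x ^+ 2)%:E)%E].

(* The sum is unconditional: the limit over the directed set of the finite
   subsets of L. *)
Definition synthesis (f : L -> H) (xi : L -> K) : H :=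
  summability.sum (fun l => xi l *: f l).

Definition analysis (f : L -> H) (x : H) : L -> K := fun l => dot x (f l).

Definition frame_operator (f : L -> H) : H -> H := synthesis f \o analysis f.

(* [pinv] is a total partial inverse; it is the inverse when the frame operator
   is bijective, as it is for a frame of H. *)
Definition canonical_dual (f : L -> H) (l : L) : H :=
  pinv [set: H] (frame_operator f) (f l).

End OneSpace.

Definition signK (eta : K) : K := if eta == 0 then 0 else eta / `|eta|.

Definition soft (eta : K) (d : R) : K :=
  signK eta * ofR k (Num.max 0 (normR eta - d)).

Definition soft_threshold (d : L -> R) (eta : L -> K) : L -> K :=
  fun l => soft (eta l) (d l).

Definition pointwise_div (kappa : L -> R) (eta : L -> K) : L -> K :=
  fun l => eta l / ofR k (kappa l).

Variables X Y : hilbertType R k.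

(* The defining equation has a unique solution when A is linear and bounded;
   0 is a default value for other maps. *)
Definition adjoint (A : X -> Y) (y : Y) : X :=
  xget 0 [set z | forall x, dot (A x) y = dot x z].

Record is_DFD (A : X -> Y) (u : L -> X) (v : L -> Y) (kappa : L -> R) : Prop :=
  IsDFD {
    DFD_kappa_gt0 : forall l, 0 < kappa l ;
    DFD_frame_u : frame [set: X] u ;
    DFD_frame_v : frame (closure (range A)) v ;
    DFD_adjoint : forall l, adjoint A (v l) = ofR k (kappa l) *: u l
  }.

Definition thresholded_coefs (v : L -> Y) (kappa d : L -> R) (alpha : R)
    (y : Y) : L -> K :=
  pointwise_div kappa
    (soft_threshold (fun l => alpha * d l / kappa l) (analysis v y)).

Definition B_DFD (u : L -> X) (v : L -> Y) (kappa d : L -> R) (alpha : R)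
    (y : Y) : X :=
  synthesis (canonical_dual u) (thresholded_coefs v kappa d alpha y).

End Frames.

(* Main.v *)
Require Import Defs.
From mathcomp Require Import all_boot all_order all_algebra.
From mathcomp Require Import all_classical all_reals all_analysis.
From mathcomp Require Import finmap complex ring lra.
From mathcomp Require summability.
Set Implicit Arguments.
Unset Strict Implicit.
Unset Printing Implicit Defensive.
Import Order.TTheory GRing.Theory Num.Theory.
Import numFieldNormedType.Exports.
Local Open Scope classical_set_scope.
Local Open Scope ring_scope.

(* Write S for the frame operator of u. Since S is bounded, symmetric and
   coercive, it is bijective, the canonical dual of u is a Bessel family
   reproducing X, and the Riesz representation of x |-> <A x, v_l> can be read
   off the frame, which gives <A x, v_l> = kappa_l <x, u_l>. On the coefficient
   side, a coefficient surviving the threshold satisfies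
   1 / kappa_l < |<y, v_l>| / (alpha d_l), so the unbounded division by kappa is
   locally Lipschitz after thresholding: this gives (a) and (b). For (c), with
   xi_l the thresholded coefficients of y^k, x_l = <x+, u_l> and
   e_l = <y^k - A x+, v_l>, AM-GM yields
   d_l |xi_l| <= d_l |x_l| + |e_l|^2 / (4 alpha) for each l, which controls
   sum_l d_l |xi_l - x_l| outside a finite set, while xi_l -> x_l on it; the
   weighted l1 convergence implies l2 convergence as inf d > 0. *)

(** * Scalars and inner products *)

Section Scalars.
Variables (R : realType) (k : scalar_kind).
Local Notation K := (scalars R k).

(** A norm is a real element of [K], so taking its real part loses nothing. Through this identity
    inequalities between norms pass from [K] to [R]. *)
Lemma ofR_normR (V : normedZmodType K) (x : V) : ofR k (normR x) = `|x|.
Proof.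
rewrite /normR; have : `|x| \is Num.real by exact: normr_real.
move: `|x|; case: k => //= z zr.
exact: RRe_real.
Qed.

Lemma ler_ofR (a b : R) : (ofR k a <= ofR k b) = (a <= b).
Proof. by case: k => //=; rewrite lecR. Qed.

Lemma ltr_ofR (a b : R) : (ofR k a < ofR k b) = (a < b).
Proof. by case: k => //=; rewrite ltcR. Qed.

Lemma ofRD (a b : R) : ofR k (a + b) = ofR k a + ofR k b.
Proof. by case: k => //=; rewrite rmorphD. Qed.

Lemma ofRM (a b : R) : ofR k (a * b) = ofR k a * ofR k b.
Proof. by case: k => //=; rewrite rmorphM. Qed.

Lemma ofR0 : ofR k 0 = 0 :> K.
Proof. by case: k => //=; rewrite rmorph0. Qed.

Lemma ofR1 : ofR k 1 = 1 :> K.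
Proof. by case: k => //=; rewrite rmorph1. Qed.

Lemma ofRN (a : R) : ofR k (- a) = - ofR k a.
Proof. by case: k => //=; rewrite rmorphN. Qed.

Lemma ofRV (a : R) : ofR k a^-1 = (ofR k a)^-1.
Proof. by case: k => //=; rewrite fmorphV. Qed.

Lemma ofR_inj : injective (@ofR R k).
Proof. by case: k => // a b; apply: complexI. Qed.

(** In the order of the complex numbers a positive element is real, so every epsilon in [K] may be
    taken in [R]. *)
Lemma ofR_gt0P (e : K) : 0 < e -> exists2 r : R, 0 < r & e = ofR k r.
Proof.
move=> e0; exists (normR e); last by rewrite ofR_normR gtr0_norm.
by rewrite -ltr_ofR ofR0 ofR_normR normr_gt0 gt_eqF.
Qed.

Section Norm.
Variable V : normedZmodType K.
Implicit Types x y : V.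

Lemma normR_ge0 x : 0 <= normR x.
Proof. by rewrite -ler_ofR ofR0 ofR_normR. Qed.

Lemma normR0 : normR (0 : V) = 0.
Proof. by apply: ofR_inj; rewrite ofR_normR normr0 ofR0. Qed.

Lemma normR_eq0 x : (normR x == 0) = (x == 0).
Proof. by rewrite -(inj_eq ofR_inj) ofR_normR ofR0 normr_eq0. Qed.

Lemma ler_normRD x y : normR (x + y) <= normR x + normR y.
Proof. by rewrite -ler_ofR ofRD !ofR_normR ler_normD. Qed.

Lemma normRN x : normR (- x) = normR x.
Proof. by apply: ofR_inj; rewrite !ofR_normR normrN. Qed.

Lemma distRC x y : normR (x - y) = normR (y - x).
Proof. by rewrite -normRN opprB. Qed.

Lemma ler_distRD z x y : normR (x - y) <= normR (x - z) + normR (z - y).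
Proof. by rewrite (le_trans _ (ler_normRD _ _))// addrA subrK. Qed.

Lemma ler_distR x y : normR x - normR y <= normR (x - y).
Proof. by rewrite lerBlDr (le_trans _ (ler_normRD _ _))// subrK. Qed.

End Norm.

Lemma normRZ (V : normedModType K) (a : K) (x : V) :
  normR (a *: x) = normR a * normR x.
Proof. by apply: ofR_inj; rewrite ofRM !ofR_normR normrZ. Qed.

Lemma normRM (a b : K) : normR (a * b) = normR a * normR b.
Proof. by apply: ofR_inj; rewrite ofRM !ofR_normR normrM. Qed.

Lemma normR_ofR (a : R) : normR (ofR k a) = `|a|.
Proof.
apply: ofR_inj; rewrite ofR_normR; case: k => //=.
by rewrite -complexr0 normc_def /= expr0n addr0 sqrtr_sqr.
Qed.

Lemma reK_ofR (a : R) : reK (ofR k a) = a.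
Proof. by case: k. Qed.

Lemma reKD (a b : K) : reK (a + b) = reK a + reK b.
Proof. by move: a b; case: k => //= a b; rewrite raddfD. Qed.

Lemma reKN (a : K) : reK (- a) = - reK a.
Proof. by move: a; case: k => //= a; rewrite raddfN. Qed.

Lemma reK0 : reK (0 : K) = 0.
Proof. by rewrite -ofR0 reK_ofR. Qed.

Lemma reK_sum (I : Type) (r : seq I) (F : I -> K) :
  reK (\sum_(i <- r) F i) = \sum_(i <- r) reK (F i).
Proof. by move: F; case: k => //= F; rewrite raddf_sum. Qed.

Lemma reK_ofRM (a : R) (b : K) : reK (ofR k a * b) = a * reK b.
Proof. by move: b; case: k => //= -[x y] /=; rewrite mul0r subr0. Qed.

Lemma reK_le_normR (a : K) : reK a <= normR a.
Proof.
rewrite -ler_ofR ofR_normR; move: a; case: k => /= a; first exact: ler_norm.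
by apply: le_trans (normc_ge_Re a); rewrite lecR ler_norm.
Qed.

Lemma conjK_K : involutive (@conjK R k).
Proof. by case: k => //=; apply: conjcK. Qed.

Lemma reK_conjK (a : K) : reK (conjK a) = reK a.
Proof. by move: a; case: k => // -[]. Qed.

Lemma normR_conjK (a : K) : normR (conjK a) = normR a.
Proof.
apply: ofR_inj; rewrite !ofR_normR; move: a; case: k => //= a.
by rewrite normcJ.
Qed.

Lemma mul_conjK (a : K) : a * conjK a = ofR k (normR a ^+ 2).
Proof.
rewrite expr2 ofRM !ofR_normR; move: a; case: k => /= a.
  by rewrite -[LHS]/(a * a) -!expr2 real_normK ?num_real.
by rewrite -expr2 sqr_normc.
Qed.

Lemma conjK_ofR (a : R) : conjK (ofR k a) = ofR k a.
Proof. by case: k => //=; rewrite /= oppr0. Qed.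

End Scalars.

Section Dot.
Variables (R : realType) (k : scalar_kind) (H : hilbertType R k).
Local Notation K := (scalars R k).
Implicit Types x y z : H.

Lemma dotDl x y z : dot (x + y) z = dot x z + dot y z.
Proof. exact: linearDl. Qed.

Lemma dotBl x y z : dot (x - y) z = dot x z - dot y z.
Proof. exact: linearBl. Qed.

Lemma dotZl (a : K) x z : dot (a *: x) z = a * dot x z.
Proof. exact: linearZl_LR. Qed.

Lemma dotBr x y z : dot z (x - y) = dot z x - dot z y.
Proof. exact: linearBr. Qed.

Lemma dotZr (a : K) x z : dot z (a *: x) = conjK a * dot z x.
Proof. exact: linearZr_LR. Qed.

Lemma dot0r x : dot x 0 = 0.
Proof. exact: linear0r. Qed.

Lemma dot_suml (I : Type) (r : seq I) (F : I -> H) z :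
  dot (\sum_(i <- r) F i) z = \sum_(i <- r) dot (F i) z.
Proof. exact: linear_sumlz. Qed.

Lemma dot_sumr (I : Type) (r : seq I) (F : I -> H) z :
  dot z (\sum_(i <- r) F i) = \sum_(i <- r) dot z (F i).
Proof. exact: linear_sumr. Qed.

Lemma dotC x y : dot x y = conjK (dot y x).
Proof. by rewrite hermitian_subproof expr0 mul1r. Qed.

Lemma reK_dotC x y : reK (dot x y) = reK (dot y x).
Proof. by rewrite dotC reK_conjK. Qed.

Lemma reK_dotxx x : reK (dot x x) = normR x ^+ 2.
Proof. by rewrite dot_norm -ofR_normR expr2 -ofRM reK_ofR. Qed.

Lemma normR_sqrB x y :
  normR (x - y) ^+ 2 = normR x ^+ 2 - 2 * reK (dot x y) + normR y ^+ 2.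
Proof.
rewrite -!reK_dotxx dotBl !dotBr !(reKD, reKN) (reK_dotC y x); ring.
Qed.

(** Expansion of t |x - y/t|^2 >= 0: Young's inequality with a free weight. *)
Lemma reK_dot_le (t : R) x y : 0 < t ->
  2 * reK (dot x y) <= t * normR x ^+ 2 + t^-1 * normR y ^+ 2.
Proof.
move=> t0; have /(mulr_ge0 (ltW t0)) : 0 <= normR (x - ofR k t^-1 *: y) ^+ 2.
  by rewrite sqr_ge0.
rewrite normR_sqrB normRZ dotZr conjK_ofR reK_ofRM normR_ofR.
rewrite ger0_norm; last by rewrite invr_ge0 ltW.
move=> h; rewrite -subr_ge0.
suff -> : t * normR x ^+ 2 + t^-1 * normR y ^+ 2 - 2 * reK (dot x y) =
  t * (normR x ^+ 2 - 2 * (t^-1 * reK (dot x y)) + (t^-1 * normR y) ^+ 2) by [].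
by field; rewrite gt_eqF.
Qed.

Lemma reK_dot_le_norm x y : reK (dot x y) <= normR x * normR y.
Proof.
have [x0|x0] := eqVneq (normR x) 0.
  by move/eqP: x0; rewrite normR_eq0 => /eqP->; rewrite linear0l normR0 mul0r reK0.
have [y0|y0] := eqVneq (normR y) 0.
  by move/eqP: y0; rewrite normR_eq0 => /eqP->; rewrite dot0r normR0 mulr0 reK0.
have xp : 0 < normR x by rewrite lt_def x0 normR_ge0.
have yp : 0 < normR y by rewrite lt_def y0 normR_ge0.
(* This weight makes both terms on the right equal to |x| |y|. *)
have := @reK_dot_le (normR y / normR x) x y (divr_gt0 yp xp).
suff -> : normR y / normR x * normR x ^+ 2 + (normR y / normR x)^-1 * normR y ^+ 2
   = 2 * (normR x * normR y) by rewrite ler_pM2l.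
by field; rewrite x0 y0.
Qed.

Lemma CauchySchwarz_dot x y : normR (dot x y) <= normR x * normR y.
Proof.
have [->|d0] := eqVneq (dot x y) 0.
  by rewrite normR0 mulr_ge0 ?normR_ge0.
have dp : 0 < normR (dot x y) by rewrite lt_def normR_eq0 d0 normR_ge0.
(* Multiplying x by the conjugate of <x, y> turns the inner product into the real number |<x, y>|^2;
   one factor |<x, y>| then cancels. *)
have := reK_dot_le_norm (conjK (dot x y) *: x) y.
rewrite dotZl mulrC mul_conjK reK_ofR normRZ normR_conjK expr2 -mulrA.
by rewrite ler_pM2l.
Qed.

End Dot.

(** * Sums over finite subsets and unconditional sums *)

Section FiniteSums.
Variables (R : realType) (L : choiceType).
Implicit Types (f g : L -> R) (F : {fset L}).

Lemma sum_fsetUD (V : nmodType) (h : L -> V) F F' :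
  \sum_(l <- (F `|` F')%fset) h l =
  \sum_(l <- F) h l + \sum_(l <- (F' `\` F)%fset) h l.
Proof.
rewrite (big_fsetID _ (mem F)) /=; congr (_ + _); apply: eq_fbigl => l.
  by rewrite !inE; case: (l \in F) (l \in F') => [] [].
by rewrite !inE /=; case: (l \in F) (l \in F') => [] [].
Qed.

(** Real-valued form of a bound on an [\esum], which keeps the estimates out of the extended
    reals. *)
Definition sums_le f (C : R) := forall F, \sum_(l <- F) f l <= C.

Lemma esum_leP f (C : R) :
  (\esum_(l in [set: L]) (f l)%:E <= C%:E)%E <-> sums_le f C.
Proof.
split=> [h F|h].
  rewrite -lee_fin; apply: le_trans h; apply: ereal_sup_ubound.
  exists [set` F]; first by split.
  by rewrite fsbig_finite// set_fsetK sumEFin.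
apply: ge_ereal_sup => _ [F [finF _] <-].
by rewrite fsbig_finite// sumEFin lee_fin.
Qed.

Lemma esum_lt_pinftyP f : (forall l, 0 <= f l) ->
  (\esum_(l in [set: L]) (f l)%:E < +oo)%E <-> exists C, sums_le f C.
Proof.
move=> f0; split=> [h|[C hC]]; last first.
  by have /esum_leP/le_lt_trans -> := hC; rewrite ?ltry.
exists (fine (\esum_(l in [set: L]) (f l)%:E)%E); apply/esum_leP.
by rewrite fineK// ge0_fin_numE// esum_ge0// => l _; rewrite lee_fin.
Qed.

Lemma sums_le_ge0 f C : sums_le f C -> 0 <= C.
Proof. by move=> /(_ fset0); rewrite big_seq_fset0. Qed.

(** Take [F0] with sum within [e] of the supremum of all finite sums: adjoining further indices
    cannot exceed that supremum. *)
Lemma sums_le_tail f C : (forall l, 0 <= f l) -> sums_le f C ->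
  forall e, 0 < e ->
  exists F0, forall F, \sum_(l <- (F `\` F0)%fset) f l < e.
Proof.
move=> f0 fC e e0.
pose E := [set \sum_(l <- F) f l | F in [set: {fset L}]].
have Esup : has_sup E.
  split; first by exists (\sum_(l <- fset0) f l), fset0.
  by exists C => _ [F _ <-]; exact: fC.
have [_ [F0 _ <-] h] := sup_adherent e0 Esup.
exists F0 => F.
have := sup_upper_bound Esup; move=> /(_ (\sum_(l <- (F0 `|` F)%fset) f l)).
rewrite sum_fsetUD => /(_ _)/le_lt_trans h2.
have : \sum_(l <- F0) f l + \sum_(l <- (F `\` F0)%fset) f l < \sum_(l <- F0) f l + e.
  by apply: h2; [exists (F0 `|` F)%fset => //; rewrite sum_fsetUD|rewrite -ltrBlDr].
by rewrite ltrD2l.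
Qed.

(** The l1 norm dominates the l2 norm; this converts the weighted l1 convergence of the coefficients
    into l2 convergence. *)
Lemma sum_sqr_le f F : (forall l, 0 <= f l) ->
  \sum_(l <- F) f l ^+ 2 <= (\sum_(l <- F) f l) ^+ 2.
Proof.
move=> f0; elim: (enum_fset F) => [|l s ih]; first by rewrite !big_nil expr0n.
rewrite !big_cons (le_trans (lerD (lexx _) ih))// sqrrD addrAC lerDl.
by rewrite mulrn_wge0// mulr_ge0// sumr_ge0.
Qed.

End FiniteSums.

Section UnconditionalSums.
Variables (R : realType) (k : scalar_kind) (L : choiceType).
Local Notation K := (scalars R k).

(** Real-epsilon form of the limit along finite subsets that [summability.sum] takes. *)
Definition has_usum (V : normedZmodType K) (g : L -> V) (s : V) :=
  forall e : R, 0 < e -> exists F0 : {fset L}, forall F : {fset L},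
    (F0 `<=` F)%fset -> normR (s - \sum_(l <- F) g l) < e.

Lemma partial_sumE (V : normedModType K) (g : L -> V) (F : {fset L}) :
  summability.partial_sum g F = \sum_(l <- F) g l.
Proof. by rewrite big_seq_fsetE. Qed.

Lemma cvg_normRP (V : normedModType K) (T : Type) (F : set_system T)
    (FF : Filter F) (f : T -> V) (x : V) :
  f @ F --> x <-> forall e : R, 0 < e -> \forall t \near F, normR (x - f t) < e.
Proof.
split=> [/cvgrPdist_lt h e e0|h].
  have /h : 0 < ofR k e by rewrite -(ofR0 R k) ltr_ofR.
  by apply: filterS => t; rewrite -ofR_normR ltr_ofR.
apply/cvgrPdist_lt => e /ofR_gt0P[r /h + ->].
by apply: filterS => t; rewrite -ofR_normR ltr_ofR.
Qed.

Lemma cauchy_normR_cvg (V : completeNormedModType K) (T : Type)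
    (F : set_system T) (FF : ProperFilter F) (f : T -> V) :
  (forall e : R, 0 < e -> exists x, \forall t \near F, normR (x - f t) < e) ->
  cvg (f @ F).
Proof.
move=> h; apply/cauchy_cvgP/cauchy_exP => e /ofR_gt0P[r /h[x hx] ->].
exists x; rewrite /= -ball_normE; apply: filterS hx => t.
by rewrite /= -ofR_normR ltr_ofR.
Qed.

Lemma has_usum_cvgP (V : normedModType K) (g : L -> V) (s : V) :
  has_usum g s <-> summability.partial_sum g @ @summability.totally L --> s.
Proof.
have PF := @summability.totally_filter L.
split=> [h|/cvg_normRP h e /h[F0 _ hF0]].
  apply/cvg_normRP => e /h[F0 hF0]; exists F0 => // F /= /hF0.
  by rewrite partial_sumE.
by exists F0 => F /hF0 /=; rewrite partial_sumE.
Qed.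

Lemma has_usum_sum (V : normedModType K) (g : L -> V) (s : V) :
  has_usum g s -> summability.sum g = s.
Proof.
have PF := @summability.totally_filter L.
by move=> /has_usum_cvgP; apply: cvg_lim; exact: norm_hausdorff.
Qed.

Lemma cauchy_has_usum (V : completeNormedModType K) (g : L -> V) :
  (forall e : R, 0 < e -> exists F0, forall F,
     normR (\sum_(l <- (F `\` F0)%fset) g l) < e) ->
  has_usum g (summability.sum g).
Proof.
have PF := @summability.totally_filter L.
move=> h; apply/has_usum_cvgP; apply: cauchy_normR_cvg => e /h[F0 hF0].
exists (\sum_(l <- F0) g l), F0 => // F /= F0F; rewrite partial_sumE.
rewrite -{1}(fsetUidPr _ _ F0F) sum_fsetUD opprD addNKr normRN.
exact: hF0.
Qed.

Lemma has_usumDZ (V : normedModType K) (c : K) (g h : L -> V) (s t : V) :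
  has_usum g s -> has_usum h t ->
  has_usum (fun l => c *: g l + h l) (c *: s + t).
Proof.
have PF := @summability.totally_filter L.
move=> /has_usum_cvgP hg /has_usum_cvgP hh; apply/has_usum_cvgP.
rewrite (_ : summability.partial_sum _ = fun F =>
  c *: summability.partial_sum g F + summability.partial_sum h F).
  by apply: cvgD => //; apply: cvgZl_tmp.
by apply/funext => F; rewrite !partial_sumE big_split scaler_sumr.
Qed.

(** Homogeneity is left out so that the notion also covers the conjugate-linear maps x |-> <y,
    x>. *)
Definition bounded_additive (V W : normedZmodType K) (phi : V -> W) :=
  (forall x y, phi (x - y) = phi x - phi y) /\
  exists C, forall x, normR (phi x) <= C * normR x.

(** Both maps are continuous, so phi s and psi t are each within e/2 of the common value on a large
    enough finite set. This is how operators are exchanged with unconditional sums below. *)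
Lemma usum_eq (V W Z : normedZmodType K) (phi : V -> Z) (psi : W -> Z)
    (g : L -> V) (h : L -> W) (s : V) (t : W) :
  bounded_additive phi -> bounded_additive psi -> has_usum g s -> has_usum h t ->
  (forall F : {fset L}, phi (\sum_(l <- F) g l) = psi (\sum_(l <- F) h l)) ->
  phi s = psi t.
Proof.
move=> [phiB [C hC]] [psiB [D hD]] gs ht hF.
apply/eqP; rewrite -subr_eq0 -normR_eq0 eq_le normR_ge0 andbT.
apply/ler_addgt0Pl => e e0; rewrite addr0.
(* The constants [C] and [D] may be zero or negative, hence the radii with denominators |C| + 1 and
   |D| + 1. *)
have P (E : R) : 0 < `|E| + 1 by rewrite ltr_wpDl.
have [F1 h1] := gs (e / 2 / (`|C| + 1)) (divr_gt0 (divr_gt0 e0 (ltr0Sn _ _)) (P _)).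
have [F2 h2] := ht (e / 2 / (`|D| + 1)) (divr_gt0 (divr_gt0 e0 (ltr0Sn _ _)) (P _)).
have {h1}h1 := h1 (F1 `|` F2)%fset (fsubsetUl _ _).
have {h2}h2 := h2 (F1 `|` F2)%fset (fsubsetUr _ _).
set F := (F1 `|` F2)%fset in h1 h2.
have aux (E x : R) : 0 <= x -> x < e / 2 / (`|E| + 1) -> E * x <= e / 2.
  move=> x0; rewrite ltr_pdivlMr// mulrC => /ltW; apply: le_trans.
  by apply: ler_wpM2r => //; rewrite (le_trans (ler_norm E))// lerDl.
rewrite (le_trans (ler_distRD (phi (\sum_(l <- F) g l)) _ _))//.
rewrite -phiB hF -psiB [leRHS](splitr e) lerD//.
  by apply: le_trans (hC _) _; apply: aux h1; exact: normR_ge0.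
rewrite psiB distRC -psiB.
by apply: le_trans (hD _) _; apply: aux h2; exact: normR_ge0.
Qed.

Lemma has_usum_le (V : normedZmodType K) (g : L -> V) (s : V) (C : R) :
  has_usum g s -> (forall F : {fset L}, normR (\sum_(l <- F) g l) <= C) ->
  normR s <= C.
Proof.
move=> gs gC; apply/ler_addgt0Pl => e /gs[F /(_ F (fsubset_refl _))] h.
rewrite -[s](subrK (\sum_(l <- F) g l)) (le_trans (ler_normRD _ _))//.
by rewrite lerD// ltW.
Qed.

End UnconditionalSums.

(** * Bessel families and frames *)

Section Bessel.
Variables (R : realType) (k : scalar_kind) (L : choiceType).
Local Notation K := (scalars R k).
Variables (H : hilbertType R k).
Implicit Types (f : L -> H) (xi : L -> K) (x y : H) (b : R) (S : set H).

(** Upper half of the frame inequality, restricted to S: for v it is given only on the closure of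
    the range of A. *)
Definition bessel_on S b f := forall x, S x ->
  sums_le (fun l => normR (dot x (f l)) ^+ 2) (b * normR x ^+ 2).

Definition bessel := bessel_on [set: H].

(** Expand |g|^2 as the sum of xi_l <f_l, g> and apply AM-GM with weight b to each term; the Bessel
    inequality at g itself bounds the second sum by |g|^2, which is absorbed. *)
Lemma bessel_on_sum_le S b f xi (F : {fset L}) : 0 < b -> bessel_on S b f ->
  S (\sum_(l <- F) xi l *: f l) ->
  normR (\sum_(l <- F) xi l *: f l) ^+ 2 <= b * \sum_(l <- F) normR (xi l) ^+ 2.
Proof.
move=> b0 fb; set g := \sum_(l <- F) _ => Sg.
have : 2 * normR g ^+ 2 <= b * (\sum_(l <- F) normR (xi l) ^+ 2) +
    b^-1 * \sum_(l <- F) normR (dot g (f l)) ^+ 2.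
  rewrite -reK_dotxx {1}/g dot_suml reK_sum !mulr_sumr -big_split /=.
  apply: ler_sum => l _; rewrite dotZl.
  apply: le_trans (_ : 2 * (normR (xi l) * normR (dot (f l) g)) <= _).
    by rewrite ler_pM2l// -normRM reK_le_normR.
  rewrite dotC normR_conjK; set p := normR (xi l); set q := normR _.
  rewrite -subr_ge0 (_ : _ - _ = b^-1 * (b * p - q) ^+ 2).
    by rewrite mulr_ge0// ?sqr_ge0// invr_ge0 ltW.
  by field; rewrite gt_eqF.
have : b^-1 * \sum_(l <- F) normR (dot g (f l)) ^+ 2 <= normR g ^+ 2.
  by rewrite ler_pdivrMl// fb.
move: (b^-1 * _) (b * _) (normR g ^+ 2) => p q r; lra.
Qed.

(* The projection onto the closed span of f is not needed: testing x against
   its own partial frame sum suffices. *)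
Lemma bessel_on_bessel S b f : 0 < b ->
  (forall (F : {fset L}) xi, S (\sum_(l <- F) xi l *: f l)) ->
  bessel_on S b f -> bessel b f.
Proof.
move=> b0 Sf fb x _ F; pose g := \sum_(l <- F) dot x (f l) *: f l.
have gb : normR g ^+ 2 <= b * \sum_(l <- F) normR (dot x (f l)) ^+ 2.
  by apply: (bessel_on_sum_le b0 fb); exact: Sf.
(* <x, g> is the sum to be bounded, and |g|^2 / b is at most that same sum, so one of its two copies
   is absorbed. *)
have := reK_dot_le x g b0.
have -> : reK (dot x g) = \sum_(l <- F) normR (dot x (f l)) ^+ 2.
  rewrite dot_sumr reK_sum; apply: eq_bigr => l _.
  by rewrite dotZr mulrC mul_conjK reK_ofR.
have : b^-1 * normR g ^+ 2 <= \sum_(l <- F) normR (dot x (f l)) ^+ 2.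
  by rewrite ler_pdivrMl.
move: (\sum_(l <- F) _) (b^-1 * _) (b * normR x ^+ 2) => p q r; lra.
Qed.

Lemma l2P xi : l2 xi <-> exists T, sums_le (fun l => normR (xi l) ^+ 2) T.
Proof. by apply: esum_lt_pinftyP => l; exact: sqr_ge0. Qed.

Section Synthesis.
Variables (f : L -> H) (b : R).
Hypotheses (b0 : 0 < b) (fb : bessel b f).

Lemma bessel_sum_le xi (F : {fset L}) :
  normR (\sum_(l <- F) xi l *: f l) ^+ 2 <= b * \sum_(l <- F) normR (xi l) ^+ 2.
Proof. exact: (bessel_on_sum_le b0 fb). Qed.

Lemma synthesis_usum xi : l2 xi ->
  has_usum (fun l => xi l *: f l) (synthesis f xi).
Proof.
move=> /l2P[T hT]; apply: cauchy_has_usum => e e0.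
(* The squared norm of a finite synthesis is at most b times the sum of the squared coefficients. *)
have e2b : 0 < e ^+ 2 / b by rewrite divr_gt0// exprn_gt0.
have [F0 hF0] := sums_le_tail (fun l => sqr_ge0 (normR (xi l))) hT e2b.
exists F0 => F; rewrite -(@ltr_pXn2r _ 2)// ?nnegrE ?normR_ge0 ?(ltW e0)//.
apply: le_lt_trans (bessel_sum_le _ _) _.
by rewrite mulrC -ltr_pdivlMr.
Qed.

Lemma synthesis_le xi T : sums_le (fun l => normR (xi l) ^+ 2) T ->
  normR (synthesis f xi) ^+ 2 <= b * T.
Proof.
move=> hT; have T0 := sums_le_ge0 hT.
have bT0 : 0 <= b * T by rewrite mulr_ge0// ltW.
rewrite -(sqr_sqrtr bT0) ler_pXn2r ?nnegrE ?normR_ge0 ?sqrtr_ge0//.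
apply: has_usum_le (synthesis_usum _) _ => [|F]; first by apply/l2P; exists T.
rewrite -[leLHS]ger0_norm ?normR_ge0// -sqrtr_sqr ler_wsqrtr//.
by rewrite (le_trans (bessel_sum_le _ _))// ler_wpM2l// ltW.
Qed.

Lemma synthesisDZ (c : K) xi xi' : l2 xi -> l2 xi' ->
  synthesis f (fun l => c * xi l + xi' l) =
  c *: synthesis f xi + synthesis f xi'.
Proof.
move=> h h'; apply: has_usum_sum.
have := has_usumDZ c (synthesis_usum h) (synthesis_usum h').
by congr has_usum; apply/funext => l; rewrite scalerDl scalerA.
Qed.

Lemma synthesisB xi xi' : l2 xi -> l2 xi' ->
  synthesis f (fun l => xi l - xi' l) = synthesis f xi - synthesis f xi'.
Proof.
move=> h h'; rewrite addrC -scaleN1r -synthesisDZ//; congr synthesis.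
by apply/funext => l; rewrite mulN1r addrC.
Qed.

Lemma analysis_l2 x : l2 (analysis f x).
Proof. by apply/l2P; exists (b * normR x ^+ 2); exact: fb. Qed.

Lemma frame_operator_usum x :
  has_usum (fun l => dot x (f l) *: f l) (frame_operator f x).
Proof. exact/synthesis_usum/analysis_l2. Qed.

Lemma frame_operatorDZ (c : K) x y :
  frame_operator f (c *: x + y) = c *: frame_operator f x + frame_operator f y.
Proof.
rewrite -synthesisDZ; [|exact: analysis_l2..].
by congr synthesis; apply/funext => l; rewrite /analysis dotDl dotZl.
Qed.

Lemma frame_operatorB x y :
  frame_operator f (x - y) = frame_operator f x - frame_operator f y.
Proof.
by rewrite addrC -scaleN1r frame_operatorDZ scaleN1r addrC.
Qed.

Lemma frame_operator_le x : normR (frame_operator f x) <= b * normR x.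
Proof.
rewrite -(@ler_pXn2r _ 2) ?nnegrE ?normR_ge0 ?mulr_ge0 ?normR_ge0 ?(ltW b0)//.
rewrite (le_trans (synthesis_le (fb (x := x) I)))//.
by rewrite exprMn expr2 mulrA.
Qed.

Lemma frame_operator_bounded : bounded_additive (frame_operator f).
Proof. by split; [exact: frame_operatorB|exists b; exact: frame_operator_le]. Qed.

Lemma dotl_bounded y : bounded_additive (fun x => dot x y).
Proof.
split; first by move=> x x'; rewrite dotBl.
by exists (normR y) => x; rewrite mulrC CauchySchwarz_dot.
Qed.

Lemma dotr_bounded y : bounded_additive (fun x => dot y x).
Proof.
split; first by move=> x x'; rewrite dotBr.
by exists (normR y) => x; rewrite CauchySchwarz_dot.
Qed.

(** Both sides are limits of the same finite sums of <x, f_l> <f_l, y>. *)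
Lemma frame_operator_sym x y :
  dot (frame_operator f x) y = dot x (frame_operator f y).
Proof.
apply: (usum_eq (dotl_bounded y) (dotr_bounded x) (frame_operator_usum x)
  (frame_operator_usum y)) => F.
rewrite dot_suml dot_sumr; apply: eq_bigr => l _.
by rewrite dotZl dotZr -dotC mulrC.
Qed.

(** * Bijectivity of the frame operator and bounds for the canonical dual *)

Section Frame.
Variable a : R.
Hypotheses (a0 : 0 < a) (ab : a <= b).
Hypothesis fa : forall x, ((a * normR x ^+ 2)%:E
   <= \esum_(l in [set: L]) (normR (dot x (f l)) ^+ 2)%:E)%E.

(** <S x, x> is the full sum of |<x, f_l>|^2. Each finite F is handled by replacing S x with a
    partial sum over a set containing F, at a cost of at most [e]. *)
Lemma frame_operator_ge x :
  a * normR x ^+ 2 <= reK (dot (frame_operator f x) x).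
Proof.
rewrite -lee_fin (le_trans (fa x))//; apply/esum_leP => F.
apply/ler_addgt0Pl => e e0.
have P : 0 < normR x + 1 by rewrite ltr_wpDl// normR_ge0.
have [F0 hF0] := frame_operator_usum x (divr_gt0 e0 P).
have {hF0} := hF0 (F `|` F0)%fset (fsubsetUr _ _).
set g := \sum_(l <- _) _ => hg.
have -> : frame_operator f x = (frame_operator f x - g) + g by rewrite subrK.
rewrite dotDl reKD addrA.
have -> : reK (dot g x) = \sum_(l <- (F `|` F0)%fset) normR (dot x (f l)) ^+ 2.
  rewrite dot_suml reK_sum; apply: eq_bigr => l _.
  by rewrite dotZl [dot (f l) x]dotC mul_conjK reK_ofR.
rewrite sum_fsetUD addrCA lerDl addr_ge0//; last first.
  by apply: sumr_ge0 => l _; exact: sqr_ge0.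
rewrite -[e]opprK addrC subr_ge0.
have := reK_dot_le_norm (- (frame_operator f x - g)) x.
rewrite normRN linearNl reKN lerNl; apply: le_trans.
rewrite lerN2.
move: hg; rewrite ltr_pdivlMr// => /ltW; apply: le_trans.
by rewrite ler_wpM2l ?normR_ge0// lerDl.
Qed.

Lemma frame_operator_lower x : a * normR x <= normR (frame_operator f x).
Proof.
have [x0|x0] := eqVneq (normR x) 0; first by rewrite x0 mulr0 normR_ge0.
have xp : 0 < normR x by rewrite lt_def x0 normR_ge0.
rewrite -(ler_pM2r xp) -mulrA -expr2 (le_trans (frame_operator_ge x))//.
exact: reK_dot_le_norm.
Qed.

(* Richardson iteration x' = x + (a/b^2)(y - S x). *)
Lemma frame_operator_approx y n : exists x,
  normR (y - frame_operator f x) ^+ 2 <= (1 - (a / b) ^+ 2) ^+ n * normR y ^+ 2.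
Proof.
elim: n => [|n [x hx]].
  exists 0; rewrite expr0 mul1r -[in frame_operator f _](subrr 0).
  by rewrite frame_operatorB subrr subr0.
set r := y - _ in hx.
(* With step t, coercivity and the bound |S r| <= b |r| give the factor 1 - 2 t a + t^2 b^2 on
   |r|^2; its minimum, at t = a / b^2, is 1 - (a / b)^2. *)
exists (ofR k (a / b ^+ 2) *: r + x); rewrite frame_operatorDZ.
rewrite [_ + frame_operator f x]addrC opprD addrA -/r normR_sqrB.
apply: (@le_trans _ _ ((1 - (a / b) ^+ 2) * normR r ^+ 2)); last first.
  have q0 : 0 <= 1 - (a / b) ^+ 2.
    rewrite subr_ge0 expr_le1// ?ler_pdivrMr// ?mul1r//.
    by rewrite divr_ge0// ltW.
  by rewrite [_ ^+ n.+1]exprS -[leRHS]mulrA ler_wpM2l.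
rewrite dotZr conjK_ofR reK_ofRM normRZ normR_ofR reK_dotC.
have t0 : 0 < a / b ^+ 2 by rewrite divr_gt0// exprn_gt0.
rewrite (gtr0_norm t0) exprMn.
have h1 : 2 * (a / b ^+ 2 * (a * normR r ^+ 2)) <=
    2 * (a / b ^+ 2 * reK (dot (frame_operator f r) r)).
  by rewrite ler_pM2l// ler_pM2l// frame_operator_ge.
have h2 : (a / b ^+ 2) ^+ 2 * normR (frame_operator f r) ^+ 2 <=
    (a / b ^+ 2) ^+ 2 * (b * normR r) ^+ 2.
  rewrite ler_pM2l ?exprn_gt0// ler_pXn2r ?nnegrE ?normR_ge0//.
    exact: frame_operator_le.
  by rewrite mulr_ge0 ?normR_ge0 ?ltW.
suff e : (1 - (a / b) ^+ 2) * normR r ^+ 2 = normR r ^+ 2 -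
   2 * (a / b ^+ 2 * (a * normR r ^+ 2)) + (a / b ^+ 2) ^+ 2 * (b * normR r) ^+ 2.
  by rewrite e; lra.
by field; rewrite gt_eqF.
Qed.

(** The residuals of the iteration decay geometrically, as the ratio q lies in [0, 1). *)
Lemma frame_operator_dense y e : 0 < e ->
  exists x, normR (y - frame_operator f x) < e.
Proof.
move=> e0; pose q := 1 - (a / b) ^+ 2.
have b_ge0 := ltW b0; have ab_gt0 : 0 < a / b by rewrite divr_gt0.
have q1 : `|q| < 1.
  rewrite ger0_norm ?subr_ge0 ?expr_le1 ?(ltW ab_gt0)//; last first.
    by rewrite ler_pdivrMr// mul1r.
  by rewrite ltrBlDr ltrDl exprn_gt0.
have P : 0 < normR y ^+ 2 + 1 by rewrite ltr_wpDl// sqr_ge0.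
have /cvgrPdist_lt/(_ (e ^+ 2 / (normR y ^+ 2 + 1))) := cvg_expr q1.
case; first by rewrite divr_gt0// exprn_gt0.
move=> n _ /(_ n (leqnn n)); rewrite sub0r normrN => hn.
have [x hx] := frame_operator_approx y n; exists x.
rewrite -(@ltr_pXn2r _ 2)// ?nnegrE ?normR_ge0 ?(ltW e0)//.
apply: le_lt_trans hx _; rewrite -/q.
move: hn; rewrite ltr_pdivlMr//; apply: le_lt_trans.
rewrite (@le_trans _ _ (`|q ^+ n| * normR y ^+ 2))//.
  by rewrite ler_wpM2r ?sqr_ge0// ler_norm.
by rewrite ler_wpM2l// lerDl.
Qed.

(** Choose x_n with S x_n -> y. The lower bound a |x| <= |S x| makes (x_n) Cauchy, and continuity of
    S sends its limit to y. *)
Lemma frame_operator_surj y : exists x, frame_operator f x = y.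
Proof.
have /choice[x hx] n : exists x, normR (y - frame_operator f x) < n.+1%:R^-1.
  by apply: frame_operator_dense; rewrite invr_gt0 ltr0Sn.
have small e : 0 < e -> \forall n \near \oo, (n.+1%:R^-1 : R) < e.
  by move=> e0; exact: (near_infty_natSinv_lt (PosNum e0)).
have cx : cvg (x n @[n --> \oo]).
  apply: cauchy_normR_cvg => e e0.
  have [N _ hN] := small _ (mulr_gt0 a0 (divr_gt0 e0 (ltr0Sn _ 1))).
  exists (x N), N => // n Nn.
  rewrite -(ltr_pM2l a0) (le_lt_trans (frame_operator_lower _))//.
  rewrite frame_operatorB (le_lt_trans (ler_distRD y _ _))//.
  rewrite [X in _ < a * X](splitr e) mulrDr ltrD//.
    by rewrite distRC (lt_trans (hx N))// hN /=.
  by rewrite (lt_trans (hx n))// hN.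
exists (lim (x n @[n --> \oo])); set z := lim _.
apply/eqP; rewrite -subr_eq0 -normR_eq0 eq_le normR_ge0 andbT.
apply/ler_addgt0Pl => e e0; rewrite addr0.
have e20 : 0 < e / 2 by rewrite divr_gt0.
have /cvg_normRP/(_ (e / 2 / b) (divr_gt0 e20 b0)) zx : x n @[n --> \oo] --> z by [].
have [n []] := filter_ex (filterI zx (small _ e20)) => h1 h2.
rewrite (le_trans (ler_distRD (frame_operator f (x n)) _ _))//.
rewrite [leRHS](splitr e) lerD//.
  rewrite -frame_operatorB (le_trans (frame_operator_le _))//.
  by rewrite mulrC -ler_pdivlMr// ltW.
by rewrite distRC ltW// (lt_trans (hx n)).
Qed.

Lemma frame_operator_inj : injective (frame_operator f).
Proof.
move=> x y xy; apply/eqP; rewrite -subr_eq0 -normR_eq0 eq_le normR_ge0 andbT.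
rewrite -(ler_pM2l a0) mulr0 (le_trans (frame_operator_lower _))//.
by rewrite frame_operatorB xy subrr normR0.
Qed.

Lemma frame_operatorK :
  cancel (pinv [set: H] (frame_operator f)) (frame_operator f).
Proof.
move=> y; apply: pinvK; apply/mem_set.
by have [x <-] := frame_operator_surj y; exists x.
Qed.

Lemma canonical_dualK l : frame_operator f (canonical_dual f l) = f l.
Proof. exact: frame_operatorK. Qed.

(** Write x = S z: by symmetry the dual coefficients of x are <z, f_l>, and |z| <= |x| / a. *)
Lemma bessel_canonical_dual : bessel (b / a ^+ 2) (canonical_dual f).
Proof.
move=> x _ F; have [z <-] := frame_operator_surj x.
under eq_bigr do rewrite frame_operator_sym canonical_dualK.
rewrite (le_trans (fb (x := z) I F))// -mulrA ler_wpM2l ?(ltW b0)//.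
rewrite mulrC ler_pdivlMr ?exprn_gt0// mulrC -exprMn.
rewrite ler_pXn2r ?nnegrE ?normR_ge0 ?mulr_ge0 ?normR_ge0 ?(ltW a0)//.
exact: frame_operator_lower.
Qed.

End Frame.
End Synthesis.

(** * Reconstruction by the canonical dual and Riesz representation *)

Section DualFrame.
Variables (f : L -> H) (a b : R).
Hypotheses (a0 : 0 < a) (ab : a <= b) (fb : bessel b f).
Hypothesis fa : forall x, ((a * normR x ^+ 2)%:E
   <= \esum_(l in [set: L]) (normR (dot x (f l)) ^+ 2)%:E)%E.

Let b0 : 0 < b := lt_le_trans a0 ab.
Let b'0 : 0 < b / a ^+ 2.
Proof. by rewrite divr_gt0// exprn_gt0. Qed.

(** S is injective and carries the partial sums of the left-hand side to those of S x. *)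
Lemma canonical_dual_reconstruction x :
  synthesis (canonical_dual f) (analysis f x) = x.
Proof.
apply: (frame_operator_inj b0 fb a0 fa).
have dfb := bessel_canonical_dual b0 fb a0 ab fa.
have idb : bounded_additive (@id H).
  by split=> //; exists 1 => y; rewrite mul1r.
apply: (usum_eq (frame_operator_bounded b0 fb) idb
  (synthesis_usum b'0 dfb (analysis_l2 fb x)) (frame_operator_usum b0 fb x)) => F /=.
elim: (enum_fset F) => [|l s ih].
  by rewrite !big_nil -[in frame_operator f _](subrr 0) (frame_operatorB b0 fb) subrr.
by rewrite !big_cons (frame_operatorDZ b0 fb) (canonical_dualK b0 fb a0 ab fa) ih.
Qed.

(** Let eta_l be the conjugate of phi(f_l) and solve S z = sum of eta_l f_l. Then <S y, z> = <y, S
    z> is the sum of <y, f_l> phi(f_l), that is phi(S y), and S is onto. *)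
Lemma frame_riesz (phi : H -> K) (C : R) :
  (forall c x y, phi (c *: x + y) = c * phi x + phi y) ->
  (forall x, normR (phi x) <= C * normR x) ->
  exists z, forall x, phi x = dot x z.
Proof.
move=> phiDZ phiC.
have phi0 : phi 0 = 0.
  have := phiDZ 1 0 0; rewrite scale1r mul1r addr0 => /eqP.
  by rewrite addrC -subr_eq subrr => /eqP.
have phiB x y : phi (x - y) = phi x - phi y.
  by rewrite addrC -scaleN1r phiDZ mulN1r addrC.
have phi_sum (F : {fset L}) (xi : L -> K) :
    phi (\sum_(l <- F) xi l *: f l) = \sum_(l <- F) xi l * phi (f l).
  elim: (enum_fset F) => [|l s ih]; first by rewrite !big_nil.
  by rewrite !big_cons phiDZ ih.
pose eta l := conjK (phi (f l)).
(* Evaluating phi at g, the partial synthesis of eta, gives the partial sum T of |eta_l|^2. Hence T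
   <= C |g| with |g|^2 <= b T, so T^2 <= C^2 b T. *)
have eta_l2 : l2 eta.
  apply/l2P; exists (C ^+ 2 * b) => F.
  set T := \sum_(l <- F) _; pose g := \sum_(l <- F) eta l *: f l.
  have T0 : 0 <= T by apply: sumr_ge0 => l _; exact: sqr_ge0.
  have gT : normR g ^+ 2 <= b * T by exact: (bessel_sum_le b0 fb).
  have phig : phi g = ofR k T.
    rewrite phi_sum /T; elim: (enum_fset F) => [|l s ih].
      by rewrite !big_nil ofR0.
    by rewrite !big_cons ofRD -ih mulrC mul_conjK normR_conjK.
  have TC : T <= C * normR g by rewrite -(ger0_norm T0) -(normR_ofR k) -phig.
  have [->|Tn0] := eqVneq T 0; first by rewrite mulr_ge0 ?sqr_ge0// ltW.
  have Tp : 0 < T by rewrite lt_def Tn0.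
  rewrite -(ler_pM2r Tp) -expr2 -mulrA (@le_trans _ _ ((C * normR g) ^+ 2))//.
    by rewrite ler_pXn2r ?nnegrE// (le_trans T0).
  by rewrite exprMn ler_wpM2l ?sqr_ge0.
have [z Sz] := frame_operator_surj b0 fb a0 ab fa (synthesis f eta).
exists z => x; have [y <-] := frame_operator_surj b0 fb a0 ab fa x.
rewrite (frame_operator_sym b0 fb) Sz.
have phib : bounded_additive phi by split=> //; exists C.
apply: (usum_eq phib (dotr_bounded y) (frame_operator_usum b0 fb y)
  (synthesis_usum b0 fb eta_l2)) => F.
rewrite phi_sum dot_sumr; apply: eq_bigr => l _.
by rewrite dotZr conjK_K mulrC.
Qed.

End DualFrame.
End Bessel.

(** * Soft thresholding *)

Section Soft.
Variables (R : realType) (k : scalar_kind).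
Local Notation K := (scalars R k).
Implicit Types (eta x : K) (t : R).

Lemma soft_eq0 eta t : normR eta <= t -> soft eta t = 0.
Proof.
by move=> h; rewrite /soft (max_idPl _) ?subr_le0// ofR0 mulr0.
Qed.

(** Above the threshold the sign is absorbed into eta, leaving a real scaling that suits the algebra
    of the Lipschitz estimate. *)
Lemma softE eta t : 0 <= t -> t < normR eta ->
  soft eta t = ofR k (1 - t / normR eta) * eta.
Proof.
move=> t0 te; have e0 : 0 < normR eta := le_lt_trans t0 te.
rewrite /soft (max_idPr _) ?subr_ge0 ?ltW// /signK -normR_eq0 gt_eqF//.
rewrite -ofR_normR -ofRV mulrAC -mulrA -ofRM mulrC; congr (ofR k _ * eta).
by field; rewrite gt_eqF.
Qed.

Lemma normR_soft eta t : 0 <= t -> normR (soft eta t) = Num.max 0 (normR eta - t).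
Proof.
move=> t0; have [h|h] := leP (normR eta) t.
  by rewrite soft_eq0// normR0 (max_idPl _)// subr_le0.
have e0 : 0 < normR eta := le_lt_trans t0 h.
rewrite softE// normRM normR_ofR (max_idPr _) ?subr_ge0 ?(ltW h)//.
rewrite ger0_norm ?subr_ge0 ?ler_pdivrMr// ?mul1r ?(ltW h)//.
by field; rewrite gt_eqF.
Qed.

Lemma dist_soft eta t : 0 <= t -> normR (soft eta t - eta) <= t.
Proof.
move=> t0; have [h|h] := leP (normR eta) t.
  by rewrite soft_eq0// sub0r normRN.
have e0 : 0 < normR eta := le_lt_trans t0 h.
rewrite softE// -[X in _ - X]mul1r -(ofR1 R k) -mulrBl -ofRN -ofRD normRM normR_ofR.
rewrite addrAC subrr sub0r normrN ger0_norm ?divr_ge0 ?(ltW e0)//.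
by rewrite divfK ?gt_eqF.
Qed.

(** Ordering the moduli leaves three cases: both arguments cut off, only [eta'] cut off, none. The
    factor 2, not sharp, comes from bounding two contributions separately in the last case. *)
Lemma soft_lipschitz_wlog eta eta' t : 0 <= t -> normR eta' <= normR eta ->
  normR (soft eta t - soft eta' t) <= 2 * normR (eta - eta').
Proof.
move=> t0 le; have d0 := normR_ge0 (eta - eta').
have dd := ler_distR eta eta'.
have [h|h] := leP (normR eta) t.
  by rewrite !soft_eq0// ?subrr ?normR0 ?mulr_ge0// (le_trans le).
have [h'|h'] := leP (normR eta') t.
  rewrite (soft_eq0 h') subr0 normR_soft// (max_idPr _) ?subr_ge0 ?ltW//.
  by move: h' dd d0; lra.
have e0 : 0 < normR eta := le_lt_trans t0 h.
have e'0 : 0 < normR eta' := le_lt_trans t0 h'.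
(* The first factor is at most 1; the second summand has modulus (t / |eta|) (|eta| - |eta'|), at
   most |eta| - |eta'|. *)
have -> : soft eta t - soft eta' t = ofR k (1 - t / normR eta) * (eta - eta')
   + ofR k (t / normR eta' - t / normR eta) * eta'.
  rewrite !softE// !ofRD !ofRN; ring.
rewrite (le_trans (ler_normRD _ _))// mulr_natl mulr2n lerD//.
  have q0 : 0 <= t / normR eta by rewrite divr_ge0// ltW.
  have q1 : t / normR eta <= 1 by rewrite ler_pdivrMr// mul1r ltW.
  by rewrite normRM normR_ofR ler_piMl// ger0_norm ?subr_ge0// lerBlDr lerDl.
rewrite normRM normR_ofR (le_trans _ dd)//.
have -> : t / normR eta' - t / normR eta =
    t * (normR eta - normR eta') / (normR eta * normR eta').
  by field; rewrite !gt_eqF.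
rewrite ger0_norm; last first.
  by rewrite divr_ge0// mulr_ge0// ?subr_ge0// normR_ge0.
have -> : t * (normR eta - normR eta') / (normR eta * normR eta') * normR eta' =
    t / normR eta * (normR eta - normR eta').
  by field; rewrite !gt_eqF.
by rewrite ler_piMl ?subr_ge0// ler_pdivrMr// mul1r ltW.
Qed.

Lemma soft_lipschitz eta eta' t : 0 <= t ->
  normR (soft eta t - soft eta' t) <= 2 * normR (eta - eta').
Proof.
move=> t0; have [/ltW|] := ltP (normR eta') (normR eta).
  exact: soft_lipschitz_wlog.
by rewrite distRC [normR (eta - _)]distRC; exact: soft_lipschitz_wlog.
Qed.

(** * Thresholding followed by division by kappa, one coefficient at a time *)

Section ThresholdedDivision.
Variables (d kappa alpha : R).
Hypotheses (d0 : 0 < d) (k0 : 0 < kappa) (alpha0 : 0 < alpha).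
Local Notation thr eta := (soft eta (alpha * d / kappa) / ofR k kappa).

Let t0 : 0 <= alpha * d / kappa.
Proof. by rewrite divr_ge0 ?mulr_ge0 ?ltW. Qed.

Lemma normR_divK eta : normR (eta / ofR k kappa) = normR eta / kappa.
Proof.
by rewrite -ofRV normRM normR_ofR ger0_norm// invr_ge0 ltW.
Qed.

(* Where the threshold does not cut both arguments off, alpha d / kappa < M
   bounds the unbounded factor 1 / kappa. *)
Lemma thr_lipschitz (dmin M : R) eta eta' : 0 < dmin -> dmin <= d ->
  normR eta <= M -> normR eta' <= M ->
  normR (thr eta - thr eta') <= 2 * M / (alpha * dmin) * normR (eta - eta').
Proof.
move=> dmin0 dmind eM e'M.
have M0 : 0 <= M := le_trans (normR_ge0 _) eM.
have ad0 : 0 < alpha * dmin by rewrite mulr_gt0.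
have ad : 0 < alpha * d by rewrite mulr_gt0.
have [h|h] := leP M (alpha * d / kappa).
  rewrite !soft_eq0 ?(le_trans eM) ?(le_trans e'M)// subrr normR0.
  by rewrite mulr_ge0 ?normR_ge0// divr_ge0 ?mulr_ge0// ltW.
rewrite -mulrBl normR_divK.
have kM : kappa^-1 <= M / (alpha * dmin).
  rewrite ler_pdivlMr// mulrC (@le_trans _ _ (alpha * d / kappa)) ?(ltW h)//.
  by rewrite ler_pM2r ?invr_gt0// ler_pM2l.
rewrite -[2 * M / _]mulrA [leRHS]mulrAC.
rewrite ler_pM ?normR_ge0 ?invr_ge0 ?(ltW k0)//.
exact: soft_lipschitz.
Qed.

Lemma thr0 : thr (0 : K) = 0.
Proof. by rewrite soft_eq0 ?normR0// mul0r. Qed.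

(** If eta survives, |eta| <= e + kappa |x|, and completing the square in d / kappa leaves e^2 / (4
    alpha): a bound uniform in kappa. *)
Lemma thr_penalty_le eta x :
  d * normR (thr eta) <=
  d * normR x + normR (eta - ofR k kappa * x) ^+ 2 / (4 * alpha).
Proof.
set e := normR (eta - _); rewrite normR_divK normR_soft//.
have e2 : 0 <= e ^+ 2 / (4 * alpha).
  by rewrite divr_ge0 ?sqr_ge0// mulr_ge0// ltW.
have dx : 0 <= d * normR x by rewrite mulr_ge0 ?normR_ge0// ltW.
have [h|h] := leP (normR eta) (alpha * d / kappa).
  by rewrite (max_idPl _) ?subr_le0// mul0r mulr0 addr_ge0.
rewrite (max_idPr _) ?subr_ge0 ?(ltW h)//.
have he : normR eta <= e + kappa * normR x.
  rewrite -(ger0_norm (ltW k0)) -(normR_ofR k) -normRM.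
  by rewrite (le_trans _ (ler_normRD _ _))// subrK.
apply: (@le_trans _ _ (d * ((e + kappa * normR x - alpha * d / kappa) / kappa))).
  by rewrite ler_pM2l// ler_pM2r ?invr_gt0// lerB.
rewrite -subr_ge0 (_ : _ - _ = (e / 2 - alpha * d / kappa) ^+ 2 / alpha).
  by rewrite divr_ge0 ?sqr_ge0// ltW.
by field; rewrite !gt_eqF.
Qed.

(** Thresholding moves eta by at most the threshold. The bound degenerates as kappa tends to 0 and
    serves on finitely many indices only. *)
Lemma thr_dist_le eta x :
  normR (thr eta - x) <=
  alpha * d / kappa ^+ 2 + normR (eta - ofR k kappa * x) / kappa.
Proof.
have kn : ofR k kappa != 0 by rewrite -(ofR0 R k) (inj_eq (@ofR_inj R k)) gt_eqF.
rewrite (le_trans (ler_distRD (eta / ofR k kappa) _ _))// lerD//.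
  rewrite -mulrBl normR_divK expr2 invfM mulrA ler_pM2r ?invr_gt0//.
  exact: dist_soft.
by rewrite -[X in _ - X](mulKf kn) [_^-1 * _]mulrC -mulrBl normR_divK.
Qed.

End ThresholdedDivision.
End Soft.

(** * Closure of a subspace, and a positive lower bound for the weights *)

Section Closure.
Variables (R : realType) (k : scalar_kind) (V : normedModType (scalars R k)).

Lemma closure_normRP (S : set V) (x : V) :
  closure S x <-> forall e : R, 0 < e -> exists2 y, S y & normR (x - y) < e.
Proof.
split=> [Sx e e0|h U].
  have /cvg_normRP/(_ e e0)/Sx[y [Sy xy]] : id @ x --> x by exact: cvg_id.
  by exists y.
move=> /nbhs_ballP[_ /ofR_gt0P[e /h[y Sy xy] ->] U_ball].
exists y; split=> //; apply: U_ball.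
by rewrite -ball_normE /= -ofR_normR ltr_ofR.
Qed.

Lemma closure_submod (S : set V) :
  S 0 -> (forall c x y, S x -> S y -> S (c *: x + y)) ->
  closure S 0 /\
  forall c x y, closure S x -> closure S y -> closure S (c *: x + y).
Proof.
move=> S0 SDZ; split; first exact: subset_closure.
move=> c x y /closure_normRP Sx /closure_normRP Sy.
apply/closure_normRP => e e0.
have P : 0 < normR c + 1 by rewrite ltr_wpDl// normR_ge0.
have e2 : 0 < e / 2 by rewrite divr_gt0.
have [x' Sx' hx] := Sx _ (divr_gt0 e2 P); have [y' Sy' hy] := Sy _ e2.
exists (c *: x' + y'); first exact: SDZ.
rewrite opprD addrACA -scalerBr (le_lt_trans (ler_normRD _ _))//.
rewrite [X in _ < X](splitr e) ler_ltD// normRZ.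
move: hx; rewrite ltr_pdivlMr// mulrC => /ltW; apply: le_trans.
by rewrite ler_wpM2r ?normR_ge0// lerDl.
Qed.

End Closure.

Lemma ereal_inf_gt0_lbound (R : realType) (T : Type) (d : T -> R) :
  (0 < ereal_inf [set (d l)%:E | l in [set: T]])%E ->
  exists2 dmin : R, 0 < dmin & forall l, dmin <= d l.
Proof.
set m := ereal_inf _ => m0.
have md l : (m <= (d l)%:E)%E by apply: ereal_inf_lbound; exists l.
case: m m0 md => [r r0 h|_ h|//]; first by exists r => [//|l]; rewrite -lee_fin.
(* An infimum [+oo] forces the index set to be empty, so any positive witness does. *)
by exists 1 => // l; have := h l; rewrite leye_eq.
Qed.

(** * Diagonal frame decompositions *)

Lemma frame_bessel_on (R : realType) (k : scalar_kind) (L : choiceType)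
    (H : hilbertType R k) (S : set H) (f : L -> H) : frame S f ->
  exists a b : R, [/\ 0 < a, a <= b, bessel_on S b f &
    forall x, S x -> ((a * normR x ^+ 2)%:E
       <= \esum_(l in [set: L]) (normR (dot x (f l)) ^+ 2)%:E)%E].
Proof.
move=> [_ [a [b [a0 ab h]]]]; exists a, b; split=> // x /h/andP[]//.
by move=> _ /esum_leP.
Qed.

Section DFD.
Variables (R : realType) (k : scalar_kind) (X Y : hilbertType R k).
Variables (A : {linear X -> Y}) (L : choiceType).
Variables (u : L -> X) (v : L -> Y) (kappa : L -> R).
Hypothesis A_bounded : exists C : R, forall x : X, normR (A x) <= C * normR x.
Hypothesis uvk : is_DFD A u v kappa.
Local Notation K := (scalars R k).

(** This is (D3) tested against x, once the adjoint is known to represent x |-> <A x, v_l>. *)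
Lemma DFD_dot (x : X) (l : L) :
  dot (A x) (v l) = ofR k (kappa l) * dot x (u l).
Proof.
have [a [b [a0 ab ub ua]]] := frame_bessel_on (DFD_frame_u uvk).
have [C hC] := A_bounded.
have [z hz] : exists z, forall x, dot (A x) (v l) = dot x z.
  apply: (frame_riesz a0 ab ub (fun y => ua y I) (C := C * normR (v l)))
    => [c y y'|y].
  - by rewrite linearP dotDl dotZl.
  - rewrite (le_trans (CauchySchwarz_dot _ _))// mulrAC.
    by rewrite ler_wpM2r ?normR_ge0.
(* The representing vector [z] excludes the default value 0 of [xget]. *)
have -> : dot (A x) (v l) = dot x (adjoint A (v l)).
  by rewrite /adjoint; case: xgetP => [z' _ ->//|/(_ z)].
by rewrite (DFD_adjoint uvk) dotZr conjK_ofR.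
Qed.

(** The data range over all of Y, but v is a frame of the closed range only. Finite combinations of
    the v_l stay in that closure, so its upper bound extends to Y with the same constant. *)
Lemma DFD_bessel_v : exists2 b, 0 < b & bessel b v.
Proof.
have [a [b [a0 ab vb _]]] := frame_bessel_on (DFD_frame_v uvk).
have b0 := lt_le_trans a0 ab; exists b => //.
have [S0 SDZ] : closure (range A) 0 /\ forall c x y, closure (range A) x ->
    closure (range A) y -> closure (range A) (c *: x + y).
  apply: closure_submod; first by exists 0; rewrite ?linear0.
  by move=> c _ _ [x _ <-] [y _ <-]; exists (c *: x + y); rewrite ?linearP.
apply: (bessel_on_bessel b0 _ vb) => F xi.
elim: (enum_fset F) => [|l s ih]; first by rewrite big_nil.
by rewrite big_cons; apply: SDZ => //; exact: (DFD_frame_v uvk).1.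
Qed.

Lemma DFD_dual : exists2 b, 0 < b & bessel b (canonical_dual u) /\
  forall x, synthesis (canonical_dual u) (analysis u x) = x.
Proof.
have [a [b [a0 ab ub ua]]] := frame_bessel_on (DFD_frame_u uvk).
have b0 := lt_le_trans a0 ab; exists (b / a ^+ 2).
  by rewrite divr_gt0// exprn_gt0.
split=> [|x].
  by apply: (bessel_canonical_dual b0 ub a0 ab) => y; exact: ua.
by apply: (canonical_dual_reconstruction a0 ab ub) => y; exact: ua.
Qed.

Variables (d : L -> R) (dmin : R).
Hypotheses (dmin0 : 0 < dmin) (dminP : forall l, dmin <= d l).

Let d0 l : 0 < d l := lt_le_trans dmin0 (dminP l).
Let kappa0 := DFD_kappa_gt0 uvk.

(** * Estimates on the thresholded coefficients *)

Section Estimates.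
Variable b : R.
Hypotheses (b0 : 0 < b) (vb : bessel b v).
Variable alpha : R.
Hypothesis alpha0 : 0 < alpha.

Lemma analysis_le y l : normR (analysis v y l) <= Num.sqrt b * normR y.
Proof.
rewrite -(@ler_pXn2r _ 2) ?nnegrE ?normR_ge0 ?mulr_ge0 ?normR_ge0 ?sqrtr_ge0//.
rewrite exprMn sqr_sqrtr ?(ltW b0)//.
by have := vb (x := y) I [fset l]%fset; rewrite big_seq_fset1.
Qed.

Lemma analysisB y y' l : analysis v (y - y') l = analysis v y l - analysis v y' l.
Proof. exact: dotBl. Qed.

(** On the ball of radius M all coefficients are at most sqrt(b) M, so the scalar Lipschitz constant
    is uniform in l. *)
Lemma thresholded_coefs_lipschitz (M : R) y y' :
  normR y <= M -> normR y' <= M ->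
  sums_le (fun l => normR (thresholded_coefs v kappa d alpha y l -
                           thresholded_coefs v kappa d alpha y' l) ^+ 2)
    ((2 * (Num.sqrt b * M) / (alpha * dmin)) ^+ 2 * (b * normR (y - y') ^+ 2)).
Proof.
move=> yM y'M F.
have M0 : 0 <= M := le_trans (normR_ge0 _) yM.
set C := 2 * _ / _.
have C0 : 0 <= C by rewrite divr_ge0 ?mulr_ge0 ?sqrtr_ge0// ltW.
apply: le_trans (_ : C ^+ 2 * \sum_(l <- F) normR (analysis v (y - y') l) ^+ 2 <= _).
  rewrite mulr_sumr; apply: ler_sum => l _; rewrite -exprMn.
  rewrite ler_pXn2r ?nnegrE ?normR_ge0 ?(mulr_ge0 C0) ?normR_ge0//.
  rewrite analysisB; apply: thr_lipschitz => //.
    by rewrite (le_trans (analysis_le _ _))// ler_wpM2l ?sqrtr_ge0.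
  by rewrite (le_trans (analysis_le _ _))// ler_wpM2l ?sqrtr_ge0.
by rewrite ler_wpM2l ?sqr_ge0//; exact: vb.
Qed.

(** Compare y with the datum 0, whose thresholded coefficients vanish. *)
Lemma thresholded_coefs_l2 y : l2 (thresholded_coefs v kappa d alpha y).
Proof.
apply/l2P; have := @thresholded_coefs_lipschitz (normR y) y 0 (lexx _).
rewrite normR0 => /(_ (normR_ge0 _)) h; eexists => F; apply: le_trans (h F).
apply: ler_sum => l _.
have -> : thresholded_coefs v kappa d alpha 0 l = 0.
  rewrite /thresholded_coefs /pointwise_div /soft_threshold /analysis linear0l.
  by rewrite thr0.
by rewrite subr0.
Qed.

(** On [F0] the distance bound applies, and it vanishes with alpha and rho; off [F0] the penalty
    bound costs rho^2 / alpha and two copies of the tail of the weighted l1 sum of x+. *)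
Lemma thresholded_coefs_error (xp : X) (y : Y) (rho : R) (F F0 : {fset L}) :
  normR (y - A xp) <= rho ->
  \sum_(l <- F) d l * normR (thresholded_coefs v kappa d alpha y l - dot xp (u l))
  <= alpha * (\sum_(l <- F0) d l * (d l / kappa l ^+ 2)) +
     rho * (Num.sqrt b * \sum_(l <- F0) d l / kappa l) +
     (b / 4) * (rho ^+ 2 / alpha) +
     2 * \sum_(l <- (F `\` F0)%fset) d l * normR (dot xp (u l)).
Proof.
move=> yrho; set xi := thresholded_coefs _ _ _ _ _.
have eE l : analysis v y l - ofR k (kappa l) * dot xp (u l) =
    analysis v (y - A xp) l by rewrite analysisB -DFD_dot.
have g0 l : 0 <= d l * normR (xi l - dot xp (u l)).
  by rewrite mulr_ge0 ?normR_ge0// ltW.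
apply: (@le_trans _ _ (\sum_(l <- F0) d l * normR (xi l - dot xp (u l)) +
    \sum_(l <- (F `\` F0)%fset) d l * normR (xi l - dot xp (u l)))).
  rewrite -sum_fsetUD fsetUC sum_fsetUD lerDl.
  by apply: sumr_ge0 => l _.
rewrite -addrA lerD//.
  rewrite mulrA !mulr_sumr -big_split /=; apply: ler_sum => l _.
  have := thr_dist_le (d0 l) (kappa0 l) alpha0 (analysis v y l) (dot xp (u l)).
  rewrite eE => /le_trans h.
  have -> : alpha * (d l * (d l / kappa l ^+ 2)) +
      rho * Num.sqrt b * (d l / kappa l) =
      d l * (alpha * d l / kappa l ^+ 2 + Num.sqrt b * rho / kappa l).
    by field; rewrite gt_eqF.
  rewrite ler_pM2l//; apply: h; rewrite lerD2l ler_pM2r ?invr_gt0//.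
  by rewrite (le_trans (analysis_le _ _))// ler_wpM2l ?sqrtr_ge0.
apply: (@le_trans _ _ (\sum_(l <- (F `\` F0)%fset)
    ((4 * alpha)^-1 * normR (analysis v (y - A xp) l) ^+ 2 +
     2 * (d l * normR (dot xp (u l)))))).
  apply: ler_sum => l _.
  have h : d l * normR (xi l) <= d l * normR (dot xp (u l)) +
      normR (analysis v (y - A xp) l) ^+ 2 / (4 * alpha).
    by rewrite -eE; exact: thr_penalty_le.
  apply: le_trans (_ : d l * normR (xi l) + d l * normR (dot xp (u l)) <= _).
    rewrite -mulrDr ler_pM2l// (le_trans (ler_normRD _ _))// normRN//.
  by rewrite [_^-1 * _]mulrC [2 * _]mulr_natl mulr2n addrA lerD2r [leRHS]addrC.
rewrite big_split /= -!mulr_sumr lerD2r.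
have -> : b / 4 * (rho ^+ 2 / alpha) = (4 * alpha)^-1 * (b * rho ^+ 2).
  by field; rewrite gt_eqF.
rewrite ler_pM2l ?invr_gt0 ?mulr_gt0// (le_trans (vb (x := y - A xp) I _))//.
by rewrite ler_pM2l// ler_pXn2r ?nnegrE ?normR_ge0// (le_trans (normR_ge0 _) yrho).
Qed.

End Estimates.

(** * Continuity and convergence of the estimator *)

Lemma B_DFD_continuous alpha : 0 < alpha -> continuous (B_DFD u v kappa d alpha).
Proof.
move=> alpha0 y; have [b b0 vb] := DFD_bessel_v.
have [c c0 [uc _]] := DFD_dual.
apply/cvg_normRP => e e0.
pose M := normR y + 1.
(* Squared Lipschitz constant of the estimator on the ball of radius [M], which contains the unit
   ball around y. *)
pose D := c * ((2 * (Num.sqrt b * M) / (alpha * dmin)) ^+ 2 * b).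
have D0 : 0 <= D.
  by rewrite mulr_ge0 ?(ltW c0)// mulr_ge0 ?sqr_ge0// ltW.
have P : 0 < Num.sqrt D + 1 by rewrite ltr_wpDl// sqrtr_ge0.
have /cvg_normRP idy : id @ y --> y by exact: cvg_id.
have h1 := idy 1 ltr01.
have h2 := idy _ (divr_gt0 e0 P).
apply: filterS (filterI h1 h2) => y' [/= yy1 yye].
have yM : normR y <= M by rewrite lerDl.
have y'M : normR y' <= M.
  by rewrite /M addrC -lerBlDr (le_trans (ler_distR _ _))// distRC ltW.
rewrite -(synthesisB c0 uc); [|exact: thresholded_coefs_l2 b0 vb _ alpha0 _..].
move: yye; rewrite ltr_pdivlMr// => /(le_lt_trans _); apply.
rewrite -(@ler_pXn2r _ 2) ?nnegrE ?normR_ge0 ?mulr_ge0 ?normR_ge0 ?(ltW P)//.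
apply: le_trans (synthesis_le c0 uc
  (thresholded_coefs_lipschitz b0 vb alpha0 yM y'M)) _.
rewrite [leLHS](_ : _ = D * normR (y - y') ^+ 2); last by rewrite /D !mulrA.
rewrite mulrC exprMn ler_wpM2l ?sqr_ge0//.
rewrite -[leLHS](sqr_sqrtr D0) ler_pXn2r ?nnegrE ?sqrtr_ge0 ?(ltW P)//.
by rewrite lerDl.
Qed.

Lemma B_DFD_cvg (xp : X) :
  (\esum_(l in [set: L]) (d l * normR (dot xp (u l)))%:E < +oo)%E ->
  forall (yk : nat -> Y) (delta alpha : nat -> R),
    (forall n, normR (yk n - A xp) <= delta n) ->
    delta n @[n --> \oo] --> (0 : R) ->
    (forall n, 0 < alpha n) ->
    alpha n @[n --> \oo] --> (0 : R) ->
    delta n ^+ 2 / alpha n @[n --> \oo] --> (0 : R) ->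
    normR (B_DFD u v kappa d (alpha n) (yk n) - xp) @[n --> \oo] --> (0 : R).
Proof.
have dx0 l : 0 <= d l * normR (dot xp (u l)).
  by rewrite mulr_ge0 ?normR_ge0// ltW.
move=> /(esum_lt_pinftyP dx0)[S hS] yk delta alpha ykdelta delta_cvg alpha0.
move=> alpha_cvg da_cvg.
have [b b0 vb] := DFD_bessel_v; have [c c0 [uc uK]] := DFD_dual.
apply/cvgrPdist_le => e e0.
(* The factor sqrt(c) / dmin converts a weighted l1 error of the coefficients into an error in X, so
   t = e / P is the accuracy to reach. *)
pose P := Num.sqrt c / dmin + 1.
have P0 : 0 < P by rewrite ltr_wpDl// divr_ge0 ?sqrtr_ge0// ltW.
pose t := e / P; have t0 : 0 < t by rewrite divr_gt0.
(* The tail counts twice, hence t / 4; the other t / 2 is left to [tau], which tends to 0 because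
   [F0] is fixed before n. *)
have [F0 hF0] := sums_le_tail dx0 hS (divr_gt0 t0 (ltr0Sn _ 3)).
pose tau n := alpha n * (\sum_(l <- F0) d l * (d l / kappa l ^+ 2)) +
     delta n * (Num.sqrt b * \sum_(l <- F0) d l / kappa l) +
     (b / 4) * (delta n ^+ 2 / alpha n).
have tau_cvg : tau n @[n --> \oo] --> (0 : R).
  rewrite [X in _ --> X](_ : _ = 0 * (\sum_(l <- F0) d l * (d l / kappa l ^+ 2)) +
     0 * (Num.sqrt b * \sum_(l <- F0) d l / kappa l) + (b / 4) * 0).
    apply: cvgD; first by apply: cvgD; apply: cvgMr_tmp.
    exact: cvgMl_tmp.
  by rewrite !mul0r mulr0 !addr0.
have /cvgrPdist_lt/(_ (t / 2) (divr_gt0 t0 (ltr0Sn _ 1))) := tau_cvg.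
apply: filterS => n; rewrite !sub0r !normrN => taun.
rewrite ger0_norm ?normR_ge0//.
have xil2 := thresholded_coefs_l2 b0 vb (alpha0 n) (yk n).
set xi := thresholded_coefs _ _ _ _ _ in xil2.
have xp_l2 : l2 (analysis u xp).
  have [a' [b' [_ _ ub _]]] := frame_bessel_on (DFD_frame_u uvk).
  exact: analysis_l2 ub _.
have sumd : sums_le (fun l => d l * normR (xi l - analysis u xp l)) t.
  move=> F.
  have := thresholded_coefs_error b0 vb (alpha0 n) F F0 (ykdelta n).
  move=> /le_trans; apply; rewrite -/(tau n).
  move: (hF0 F) (ler_norm (tau n)) taun.
  by move: (\sum_(l <- _) _) `|tau n| (tau n) => p q r; lra.
have sum2 : sums_le (fun l => normR (xi l - analysis u xp l) ^+ 2) ((t / dmin) ^+ 2).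
  move=> F; rewrite (le_trans (sum_sqr_le _ _))// => [l|]; first exact: normR_ge0.
  rewrite ler_pXn2r ?nnegrE ?(ltW (divr_gt0 t0 dmin0))//.
    rewrite ler_pdivlMr// mulrC mulr_sumr (le_trans _ (sumd F))//.
    by apply: ler_sum => l _; rewrite ler_wpM2r ?normR_ge0.
  by apply: sumr_ge0 => l _; exact: normR_ge0.
(* As x+ is the dual synthesis of its own coefficients, the error is the synthesis of the
   coefficient differences. *)
have -> : B_DFD u v kappa d (alpha n) (yk n) - xp =
    synthesis (canonical_dual u) (fun l => xi l - analysis u xp l).
  by rewrite (synthesisB c0 uc)// uK.
rewrite -(@ler_pXn2r _ 2) ?nnegrE ?normR_ge0 ?(ltW e0)//.
apply: le_trans (synthesis_le c0 uc sum2) _.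
rewrite -(sqr_sqrtr (ltW c0)) -exprMn ler_pXn2r ?nnegrE ?(ltW e0)//.
  have -> : Num.sqrt c * (t / dmin) = e * (Num.sqrt c / dmin / P).
    by rewrite /t -!mulrA mulrCA; congr (e * _); ring.
  by rewrite ler_piMr ?(ltW e0)// ler_pdivrMr// mul1r lerDl.
by rewrite mulr_ge0 ?sqrtr_ge0 ?(ltW (divr_gt0 t0 dmin0)).
Qed.

End DFD.

Theorem theorem4p3 (R : realType) (k : scalar_kind) (X Y : hilbertType R k)
    (A : {linear X -> Y}) (L : choiceType)
    (u : L -> X) (v : L -> Y) (kappa d : L -> R)
    (A_bounded : exists C : R, forall x : X, normR (A x) <= C * normR x)
    (uvk_DFD : is_DFD A u v kappa)
    (d_inf_gt0 : (0 < ereal_inf [set (d l)%:E | l in [set: L]])%E) :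
  [/\ (forall alpha : R, 0 < alpha ->
         forall y : Y, l2 (thresholded_coefs v kappa d alpha y)),
      (forall alpha : R, 0 < alpha ->
         continuous (B_DFD u v kappa d alpha)) &
      (forall (y : Y) (xp : X), y = A xp ->
         (\esum_(l in [set: L]) (d l * normR (dot xp (u l)))%:E < +oo)%E ->
       forall (yk : nat -> Y) (delta alpha : nat -> R),
         (forall n, normR (yk n - y) <= delta n) ->
         delta n @[n --> \oo] --> (0 : R) ->
         (forall n, 0 < alpha n) ->
         alpha n @[n --> \oo] --> (0 : R) ->
         delta n ^+ 2 / alpha n @[n --> \oo] --> (0 : R) ->
         normR (B_DFD u v kappa d (alpha n) (yk n) - xp)
           @[n --> \oo] --> (0 : R))].
Proof.
have [dmin dmin0 dminP] := ereal_inf_gt0_lbound d_inf_gt0.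
split=> [alpha alpha0 y|alpha|y xp ->].
- have [b b0 vb] := DFD_bessel_v uvk_DFD.
  exact: (thresholded_coefs_l2 uvk_DFD dmin0 dminP b0 vb alpha0).
- exact: (B_DFD_continuous uvk_DFD dmin0 dminP).
- exact: (B_DFD_cvg A_bounded uvk_DFD dmin0 dminP).
Qed.
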